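(* Let $S$ be an additively idempotent semiring. Then: (1) Every left $S$-semimodule can be embedded in an e-injective left $S$-semimodule. (2) Every injective left $S$-semimodule is e-injective.
   Context: A semiring is $(S,+,\cdot,0,1)$ with $(S,+,0)$ a commutative monoid, $(S,\cdot,1)$ a monoid, multiplication distributing over addition on both sides, and $0s=0=s0$ for all $s$. It is additively idempotent if $s+s=s$ for all $s\in S$. A left $S$-semimodule is a commutative monoid $(M,+,0)$ with a scalar multiplication $S\times M\to M$ satisfying $(ss')m=s(s'm)$, $s(m+m')=sm+sm'$, $(s+s')m=sm+s'm$, $1m=m$, $s0=0=0m$. Homomorphisms preserve $+$, $0$ and scalar multiplication; ${}_S\mathcal{M}$ is the category of left $S$-semimodules and $\mathcal{M}$ the category of commutative monoids. $M\in{}_S\mathcal{M}$ is injective if for every injective homomorphism $\mu:A\to B$ in ${}_S\mathcal{M}$ and every homomorphism $f:A\to M$ there is a homomorphism $\tilde f:B\to M$ with $\tilde f\mu=f$. A sequence $0\to A\xrightarrow{f}B\xrightarrow{g}C\to 0$ in ${}_S\mathcal{M}$ (or in $\mathcal{M}$) is short exact if $f$ is a categorical kernel of $g$ and $g$ is a categorical cokernel of $f$ (kernels and cokernels in the sense of categories with zero morphisms). $M\in{}_S\mathcal{M}$ is e-injective if the contravariant functor $\mathrm{Hom}_S(-,M):{}_S\mathcal{M}\to\mathcal{M}$ sends every short exact sequence $0\to A\to B\to C\to 0$ to a short exact sequence $0\to\mathrm{Hom}_S(C,M)\to\mathrm{Hom}_S(B,M)\to\mathrm{Hom}_S(A,M)\to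 0$ in $\mathcal{M}$. *)

(* Defs.v *)
From HB Require Import structures.
From mathcomp Require Import all_boot all_algebra.
From mathcomp Require Import boolp.

Set Implicit Arguments.
Unset Strict Implicit.
Unset Printing Implicit Defensive.

Import GRing.Theory.

Local Open Scope ring_scope.

Definition additively_idempotent (S : pzSemiRingType) : Prop :=
  forall s : S, s + s = s.

(* Carries only a commutative monoid structure (pointwise addition): S need not
   be commutative, so Hom(A, M) is in general not an S-semimodule. *)
Definition hom (S : pzSemiRingType) (A M : lSemiModType S) : Type :=
  {linear A -> M}.

Lemma hom_eqP (S : pzSemiRingType) (A M : lSemiModType S) (f g : {linear A -> M}) :
  f =1 g -> f = g :> hom A M.
Proof.
move=> /funext; case: f g => [f [[f1] [f2]]] [g [[g1] [g2]]] /= fg.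
by case: _ / fg g1 g2 => g1 g2; congr GRing.Linear.Pack;
  congr GRing.Linear.Class; [congr Algebra.isNmodMorphism.Axioms_|
  congr GRing.isScalable.Axioms_]; apply: Prop_irrelevance.
Qed.

Section HomNmod.
Variables (S : pzSemiRingType) (A M : lSemiModType S).

Definition hom_zero : hom A M := (\0 : A -> M).
Definition hom_add (f g : hom A M) : hom A M :=
  ((f : {linear A -> M}) \+ (g : {linear A -> M})).

Lemma hom_addA : associative hom_add.
Proof. by move=> f g h; apply: hom_eqP => x /=; rewrite addrA. Qed.
Lemma hom_addC : commutative hom_add.
Proof. by move=> f g; apply: hom_eqP => x /=; rewrite addrC. Qed.
Lemma hom_add0 : left_id hom_zero hom_add.
Proof. by move=> f; apply: hom_eqP => x /=; rewrite add0r. Qed.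

HB.instance Definition _ := gen_eqMixin (hom A M).
HB.instance Definition _ := gen_choiceMixin (hom A M).
HB.instance Definition _ :=
  GRing.isNmodule.Build (hom A M) hom_addA hom_addC hom_add0.
End HomNmod.

Section Precomposition.
Variables (S : pzSemiRingType) (A B M : lSemiModType S) (f : {linear A -> B}).

Definition hom_precomp (u : hom B M) : hom A M :=
  ((u : {linear B -> M}) \o f).

Lemma hom_precomp_is_nmod_morphism : nmod_morphism hom_precomp.
Proof. by split=> [|u v]; apply: hom_eqP. Qed.

HB.instance Definition _ :=
  GRing.isNmodMorphism.Build (hom B M) (hom A M) hom_precomp
    hom_precomp_is_nmod_morphism.
End Precomposition.

Arguments hom_precomp {S A B} M f u.

(* Universal properties in a category with zero morphisms; equality of morphisms
   is written pointwise, which agrees with Leibniz equality by hom_eqP. *)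
Section SemimoduleExactness.
Variable S : pzSemiRingType.
Implicit Types A B C D : lSemiModType S.

Definition smod_is_kernel A B C (f : {linear A -> B}) (g : {linear B -> C}) :
    Prop :=
  g \o f =1 \0 /\
  forall D (h : {linear D -> B}), g \o h =1 \0 ->
    exists2 k : {linear D -> A}, f \o k =1 h &
      forall k' : {linear D -> A}, f \o k' =1 h -> k' =1 k.

Definition smod_is_cokernel A B C (f : {linear A -> B}) (g : {linear B -> C}) :
    Prop :=
  g \o f =1 \0 /\
  forall D (h : {linear B -> D}), h \o f =1 \0 ->
    exists2 k : {linear C -> D}, k \o g =1 h &
      forall k' : {linear C -> D}, k' \o g =1 h -> k' =1 k.

Definition smod_short_exact A B C (f : {linear A -> B}) (g : {linear B -> C}) :
    Prop :=
  smod_is_kernel f g /\ smod_is_cokernel f g.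

End SemimoduleExactness.

Section MonoidExactness.
Implicit Types A B C D : nmodType.

Definition cmon_is_kernel A B C (f : {additive A -> B}) (g : {additive B -> C}) :
    Prop :=
  g \o f =1 \0 /\
  forall D (h : {additive D -> B}), g \o h =1 \0 ->
    exists2 k : {additive D -> A}, f \o k =1 h &
      forall k' : {additive D -> A}, f \o k' =1 h -> k' =1 k.

Definition cmon_is_cokernel A B C (f : {additive A -> B})
    (g : {additive B -> C}) : Prop :=
  g \o f =1 \0 /\
  forall D (h : {additive B -> D}), h \o f =1 \0 ->
    exists2 k : {additive C -> D}, k \o g =1 h &
      forall k' : {additive C -> D}, k' \o g =1 h -> k' =1 k.

Definition cmon_short_exact A B C (f : {additive A -> B})
    (g : {additive B -> C}) : Prop :=
  cmon_is_kernel f g /\ cmon_is_cokernel f g.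

End MonoidExactness.

Section Injectivity.
Variable S : pzSemiRingType.
Implicit Types A B C M : lSemiModType S.

Definition smod_injective M : Prop :=
  forall A B (mu : {linear A -> B}), injective mu ->
  forall f : {linear A -> M}, exists ft : {linear B -> M}, ft \o mu =1 f.

Definition smod_e_injective M : Prop :=
  forall A B C (f : {linear A -> B}) (g : {linear B -> C}),
    smod_short_exact f g ->
    cmon_short_exact (hom_precomp M g) (hom_precomp M f).

Definition smod_embeds_in A M : Prop :=
  exists i : {linear A -> M}, injective i.

End Injectivity.

(* Main.v *)
Require Import Defs.
From mathcomp Require Import all_boot all_algebra.
From HB Require Import structures.
From mathcomp Require Import boolp.

(** Over an additively idempotent S every semimodule is ordered by
    a <= b iff a + b = b.  For a type T, the additive maps from S to the
    monoid (T -> Prop, /\, True) form a semimodule E(T) for the action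
    (t F)(s) = F(s t).  It is injective: f : A -> E(T) extends along
    mu : A -> B by taking "s b <= mu a and f a 1 x, for some a" as the value of
    the extension at b, s, x.  Every M embeds in E(M) by
    m |-> (s, x |-> s m <= x), so (1) follows from (2).

    For (2), Hom(-, M) always sends cokernels to kernels, and injectivity of M
    makes Hom(B, M) -> Hom(A, M) surjective.  What remains is that u f = v f
    implies u + w g = v + w g for some w : C -> M.  As M is a retract of E(M),
    it suffices to find w : C -> E(M), and (s, x |-> s c = 0) is a suitable
    value of w at c: if s g(b) = 0 then s b lies in A, where u and v agree. *)

Set Implicit Arguments.
Unset Strict Implicit.
Unset Printing Implicit Defensive.

Import GRing.Theory.

Local Open Scope ring_scope.

(** * The coinduced semimodule E(T) *)

Section PropCoinduced.
Variables (S : pzSemiRingType) (T : Type).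

Record prop_coind := PropCoind {
  prop_coind_fun :> S -> T -> Prop;
  prop_coind0 : forall x, prop_coind_fun 0 x;
  prop_coindD : forall s t x,
    prop_coind_fun (s + t) x <-> prop_coind_fun s x /\ prop_coind_fun t x }.

Lemma prop_coind_eq (F G : prop_coind) :
  (forall s x, F s x <-> G s x) -> F = G.
Proof.
case: F G => [F F0 FD] [G G0 GD] /= FG.
have eFG : F = G by apply/funext => s; apply/funext => x; apply/propext.
by case: _ / eFG G0 GD {FG} => G0 GD; congr PropCoind; apply: Prop_irrelevance.
Qed.

Definition prop_coind_zero : prop_coind.
Proof. by exists (fun _ _ => True). Defined.

Definition prop_coind_add (F G : prop_coind) : prop_coind.
Proof.
exists (fun s x => F s x /\ G s x) => [x|s t x].
  by split; apply: prop_coind0.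
by rewrite !(propext (prop_coindD _ _ _ _)); tauto.
Defined.

Definition prop_coind_scale (t : S) (F : prop_coind) : prop_coind.
Proof.
exists (fun s x => F (s * t) x) => [x|s s' x].
  by rewrite mul0r; apply: prop_coind0.
by rewrite mulrDl; apply: prop_coindD.
Defined.

HB.instance Definition _ := gen_eqMixin prop_coind.
HB.instance Definition _ := gen_choiceMixin prop_coind.

Lemma prop_coind_addA : associative prop_coind_add.
Proof. by move=> F G H; apply: prop_coind_eq => s x /=; tauto. Qed.
Lemma prop_coind_addC : commutative prop_coind_add.
Proof. by move=> F G; apply: prop_coind_eq => s x /=; tauto. Qed.
Lemma prop_coind_add0 : left_id prop_coind_zero prop_coind_add.
Proof. by move=> F; apply: prop_coind_eq => s x /=; tauto. Qed.

HB.instance Definition _ := GRing.isNmodule.Build prop_coind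
  prop_coind_addA prop_coind_addC prop_coind_add0.

Lemma prop_coind_scaleA (a b : S) (F : prop_coind) :
  prop_coind_scale a (prop_coind_scale b F) = prop_coind_scale (a * b) F.
Proof. by apply: prop_coind_eq => s x /=; rewrite mulrA. Qed.
Lemma prop_coind_scale0 (F : prop_coind) : prop_coind_scale 0 F = 0.
Proof.
by apply: prop_coind_eq => s x /=; rewrite mulr0; split=> // _; apply: prop_coind0.
Qed.
Lemma prop_coind_scale1 : left_id 1 prop_coind_scale.
Proof. by move=> F; apply: prop_coind_eq => s x /=; rewrite mulr1. Qed.
Lemma prop_coind_scaleDr : right_distributive prop_coind_scale +%R.
Proof. by move=> a F G; apply: prop_coind_eq. Qed.
Lemma prop_coind_scaleDl (F : prop_coind) :
  {morph prop_coind_scale^~ F : a b / a + b}.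
Proof.
by move=> a b; apply: prop_coind_eq => s x /=; rewrite mulrDr; apply: prop_coindD.
Qed.

HB.instance Definition _ := GRing.Nmodule_isLSemiModule.Build S prop_coind
  prop_coind_scaleA prop_coind_scale0 prop_coind_scale1 prop_coind_scaleDr
  prop_coind_scaleDl.

Lemma prop_coindDE (F G : prop_coind) s x :
  (F + G)%R s x <-> F s x /\ G s x.
Proof. by []. Qed.

Lemma prop_coindZE t (F : prop_coind) s x : (t *: F) s x <-> F (s * t) x.
Proof. by []. Qed.
End PropCoinduced.

Definition additive_of (A B : nmodType) (f : A -> B) (fD : nmod_morphism f) :
    {additive A -> B} :=
  HB.pack f (GRing.isNmodMorphism.Build A B f fD).

(** * Kernels on elements, and left exactness of Hom(-, M) *)

Section SemimoduleExactSequences.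
Variable S : pzSemiRingType.

Definition linear_of (A B : lSemiModType S) (f : A -> B) (fS : semilinear f) :
    {linear A -> B} :=
  HB.pack f (GRing.isSemilinear.Build S A B *:%R f fS).

Fact orbit_semilinear (B : lSemiModType S) (b : B) :
  semilinear (fun s : S^o => (s : S) *: b).
Proof. by split=> [s t|s t]; rewrite ?scalerA ?scalerDl. Qed.

(** S is free on 1, so elements of B are maps out of S. Testing a kernel against these maps turns
    its universal property into facts about elements. *)
Definition orbit_map (B : lSemiModType S) (b : B) : {linear S^o -> B} :=
  linear_of (orbit_semilinear b).

(** When f a = f a', the orbit maps of a and a' are two lifts of the orbit map of f a; uniqueness of
    lifts identifies them, and evaluation at 1 gives a = a'. *)
Lemma smod_kernel_inj (A B C : lSemiModType S) (f : {linear A -> B})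
    (g : {linear B -> C}) : smod_is_kernel f g -> injective f.
Proof.
move=> [gf0 kerf] a a' faa'.
have [|k _ uk] := kerf _ (orbit_map (f a)).
  by move=> s /=; rewrite linearZ /= (gf0 a : g (f a) = 0) scaler0.
have ea := uk (orbit_map a) (fun s => linearZ_LR f s a).
have ea' : orbit_map a' =1 k by apply: uk => s /=; rewrite linearZ /= faa'.
by rewrite -[a]scale1r -[a']scale1r; exact: etrans (ea 1) (esym (ea' 1)).
Qed.

Lemma smod_kernel_zero (A B C : lSemiModType S) (f : {linear A -> B})
    (g : {linear B -> C}) : smod_is_kernel f g ->
  forall b, g b = 0 -> exists a, f a = b.
Proof.
move=> [_ kerf] b gb0.
have [|k fk _] := kerf _ (orbit_map b).
  by move=> s /=; rewrite linearZ /= gb0 scaler0.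
by exists (k 1); rewrite (fk 1 : f (k 1) = 1 *: b) scale1r.
Qed.

Lemma hom_precomp_kernel (M A B C : lSemiModType S) (f : {linear A -> B})
    (g : {linear B -> C}) :
  smod_is_cokernel f g -> cmon_is_kernel (hom_precomp M g) (hom_precomp M f).
Proof.
move=> [gf0 cokg]; split=> [w|D h fh0].
  by apply: hom_eqP => a /=; rewrite (gf0 a : g (f a) = 0) linear0.
have factors d : exists k : Defs.hom C M, hom_precomp M g k = h d.
  have [|k kg _] := cokg _ (h d : {linear B -> M}).
    by move=> a; move: (congr1 (fun p : Defs.hom A M => p a) (fh0 d)).
  by exists k; apply: hom_eqP => b; exact: kg.
have precomp_inj : injective (hom_precomp M g).
  move=> p q pq; have [|k _ uk] := cokg _ (hom_precomp M g p : {linear B -> M}).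
    by move=> a /=; rewrite (gf0 a : g (f a) = 0) linear0.
  apply: hom_eqP => c; rewrite (uk p) ?(uk q) // => b.
  by rewrite pq.
have [k kE] := choice factors.
(* The pointwise choice of factors is additive because precomposition with g is injective. *)
have kD : nmod_morphism k.
  split=> [|d d']; apply: precomp_inj; first by rewrite kE !raddf0.
  by rewrite kE !raddfD /= !kE.
exists (additive_of kD) => [d|k' k'E d]; first exact: kE.
by apply: precomp_inj; rewrite (kE d); exact: k'E.
Qed.

End SemimoduleExactSequences.

(** * The natural order of a semimodule over an idempotent semiring *)

Section IdempotentSemiring.
Variables (S : pzSemiRingType) (idemS : additively_idempotent S).

Lemma smod_addrr (M : lSemiModType S) (m : M) : m + m = m.
Proof. by rewrite -[m]scale1r -scalerDl idemS. Qed.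

(** Idempotence gives m = m + (m + n) = m + n = 0. This is what makes the annihilator predicates of
    [annihilator_val] additive. *)
Lemma smod_addr_eq0 (M : lSemiModType S) (m n : M) :
  m + n = 0 -> m = 0 /\ n = 0.
Proof.
move=> mn0; split.
  by rewrite -[m]addr0 -mn0 addrA smod_addrr.
by rewrite -[n]add0r -mn0 -addrA smod_addrr.
Qed.

(** A sum is a least upper bound for the natural order. Naming it c lets the lemma apply to both (s
    + t) m and s (m + n). *)
Lemma smod_le_add (M : lSemiModType S) (m n c x : M) : m + n = c ->
  c + x = x <-> m + x = x /\ n + x = x.
Proof.
move=> <-; split=> [le_x|[mx nx]]; last by rewrite -addrA nx.
split; rewrite -{1}le_x !addrA ?smod_addrr //.
by rewrite (addrC n) -(addrA m) smod_addrr.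
Qed.

(** * Injectivity of E(T) *)

Section Extension.
Variables (T : Type) (A B : lSemiModType S).
Variables (mu : {linear A -> B}) (mu_inj : injective mu).
Variable f : {linear A -> prop_coind S T}.

Definition coind_ext_fun (b : B) (s : S) (x : T) : Prop :=
  exists2 a, s *: b + mu a = mu a & f a 1 x.

Lemma coind_ext_lower_bounds (b b' c : B) x : b + b' = c ->
  (exists2 a, c + mu a = mu a & f a 1 x) <->
  (exists2 a, b + mu a = mu a & f a 1 x) /\
  (exists2 a, b' + mu a = mu a & f a 1 x).
Proof.
move=> bb'; split=> [[a le_a fa]|[[a le_a fa] [a' le_a' fa']]].
  by have [le le'] := (smod_le_add (mu a) bb').1 le_a; split; exists a.
(* The sum a + a' bounds both terms, and f sends it to the conjunction of the two values. *)
exists (a + a'); last by rewrite linearD; apply/prop_coindDE.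
by rewrite -bb' linearD /= addrACA le_a le_a'.
Qed.

Definition coind_ext_val (b : B) : prop_coind S T.
Proof.
exists (coind_ext_fun b) => [x|s t x].
  by exists 0; rewrite ?scale0r ?add0r ?linear0.
by apply: coind_ext_lower_bounds; rewrite scalerDl.
Defined.

Fact coind_ext_semilinear : semilinear coind_ext_val.
Proof.
split=> [t b|b b']; apply: prop_coind_eq => s x /=.
  by rewrite /coind_ext_fun scalerA.
by apply: coind_ext_lower_bounds; rewrite scalerDr.
Qed.

Lemma coind_ext_val_mu a : coind_ext_val (mu a) = f a.
Proof.
apply: prop_coind_eq => s x /=.
have fE : f (s *: a) 1 x <-> f a s x.
  by rewrite linearZ /= mul1r.
split=> [[a' le_a' fa']|fa]; last first.
  by exists (s *: a); [rewrite linearZ smod_addrr | apply/fE].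
(* Injectivity of mu reflects s mu(a) <= mu(a') to s a <= a'. Then f a' = f (s a) + f a', so f a'
   implies f (s a) pointwise. *)
apply/fE; rewrite -linearZ -linearD in le_a'; move/mu_inj: le_a' => le_a'.
by move: fa'; rewrite -le_a' linearD => /prop_coindDE[].
Qed.
End Extension.

Lemma prop_coind_injective (T : Type) : smod_injective (prop_coind S T).
Proof.
move=> A B mu mu_inj f; exists (linear_of (coind_ext_semilinear mu f)) => a.
exact: coind_ext_val_mu.
Qed.

(** * The embedding of M into E(M) *)

Section Embedding.
Variable M : lSemiModType S.

Definition coind_emb_val (m : M) : prop_coind S M.
Proof.
exists (fun s x => s *: m + x = x) => [x|s t x].
  by rewrite scale0r add0r.
by apply: smod_le_add; rewrite scalerDl.
Defined.

Fact coind_emb_semilinear : semilinear coind_emb_val.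
Proof.
split=> [t m|m n]; apply: prop_coind_eq => s x /=.
  by rewrite scalerA.
by apply: smod_le_add; rewrite scalerDr.
Qed.

Lemma smod_embeds_in_prop_coind : smod_embeds_in M (prop_coind S M).
Proof.
exists (linear_of coind_emb_semilinear) => m n mn.
have le x : m + x = x <-> n + x = x.
  have : coind_emb_val m 1 x <-> coind_emb_val n 1 x.
    by rewrite (mn : coind_emb_val m = coind_emb_val n).
  by rewrite /= !scale1r.
(* Equal sets of upper bounds give n <= m and m <= n; antisymmetry concludes. *)
have nm := (le m).1 (smod_addrr m).
have mn' := (le n).2 (smod_addrr n).
by rewrite -nm addrC.
Qed.
End Embedding.

(** * Annihilators, and right exactness of Hom(-, M) for injective M *)

Definition annihilator_val T (C : lSemiModType S) (c : C) : prop_coind S T.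
Proof.
exists (fun s _ => s *: c = 0) => [x|s t x]; first exact: scale0r.
by rewrite scalerDl; split=> [/smod_addr_eq0|[-> ->]]; rewrite ?addr0.
Defined.

Fact annihilator_semilinear T (C : lSemiModType S) :
  semilinear (@annihilator_val T C).
Proof.
split=> [t c|c d]; apply: prop_coind_eq => s x /=; first by rewrite scalerA.
by rewrite scalerDr; split=> [/smod_addr_eq0|[-> ->]]; rewrite ?addr0.
Qed.

Lemma prop_coind_absorb T (A B C : lSemiModType S) (f : {linear A -> B})
    (g : {linear B -> C}) (u v : {linear B -> prop_coind S T}) :
  smod_is_kernel f g -> u \o f =1 v \o f ->
  forall b, u b + annihilator_val T (g b) = v b + annihilator_val T (g b).
Proof.
move=> kerf ufvf b; apply: prop_coind_eq => s x.
rewrite !prop_coindDE /=.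
suff uv : s *: g b = 0 -> u b s x <-> v b s x by tauto.
rewrite -linearZ /= => /(smod_kernel_zero kerf)[a fa].
(* The value of u b at s is that of u (s b) at 1, and s b = f a. *)
rewrite -[s in u b s]mul1r -[s in v b s]mul1r -!prop_coindZE -!linearZ -fa.
by rewrite (ufvf a : u (f a) = v (f a)).
Qed.

Lemma smod_injective_absorb (M A B C : lSemiModType S) (f : {linear A -> B})
    (g : {linear B -> C}) (u v : {linear B -> M}) :
  smod_injective M -> smod_is_kernel f g -> u \o f =1 v \o f ->
  exists w : {linear C -> M}, forall b, u b + w (g b) = v b + w (g b).
Proof.
move=> injM kerf ufvf; have [i i_inj] := smod_embeds_in_prop_coind M.
(* Extending the identity of M along i yields a retraction r of i, which carries the identity found
   in E(M) back to M. *)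
have [r ri] := injM _ _ i i_inj idfun.
exists (r \o linear_of (@annihilator_semilinear M C)) => b /=.
rewrite -[u b](ri _) -[v b](ri _) /= -!linearD; congr (r _).
apply: (prop_coind_absorb (u := i \o u) (v := i \o v) kerf) => a /=.
by rewrite (ufvf a : u (f a) = v (f a)).
Qed.

Lemma hom_precomp_cokernel (M A B C : lSemiModType S) (f : {linear A -> B})
    (g : {linear B -> C}) : smod_injective M -> smod_is_kernel f g ->
  cmon_is_cokernel (hom_precomp M g) (hom_precomp M f).
Proof.
move=> injM kerf; split=> [w|D h hg0].
  by apply: hom_eqP => a /=; rewrite (kerf.1 a : g (f a) = 0) linear0.
have ext (p : Defs.hom A M) : exists q : Defs.hom B M, hom_precomp M f q = p.
  have [q qf] := injM _ _ f (smod_kernel_inj kerf) p.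
  by exists q; apply: hom_eqP; exact: qf.
(* As h kills every w g, it cannot separate u from u + w g. Hence h depends only on the restriction
   along f, and h (e p) does not depend on the chosen extension e p. *)
have h_wd (u v : Defs.hom B M) :
    hom_precomp M f u = hom_precomp M f v -> h u = h v.
  move=> uv.
  have [|w uwvw] := smod_injective_absorb (u := u) (v := v) injM kerf.
    by move=> a; exact: (congr1 (fun p : Defs.hom A M => p a) uv).
  have hDw (p : Defs.hom B M) : h (p + hom_precomp M g w) = h p.
    by rewrite raddfD /= (hg0 w : h (hom_precomp M g w) = 0) addr0.
  by rewrite -hDw -(hDw v); congr (h _); apply: hom_eqP.
have [e eE] := choice ext.
have kD : nmod_morphism (h \o e).
  split=> [|p q] /=.
    by rewrite -(raddf0 h); apply: h_wd; rewrite eE raddf0.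
  by rewrite -raddfD; apply: h_wd; rewrite raddfD /= !eE.
exists (additive_of kD) => [u|k' k'E p] /=; first by apply: h_wd; rewrite eE.
by rewrite -{1}[p]eE; exact: k'E.
Qed.

Lemma smod_injective_e_injective (M : lSemiModType S) :
  smod_injective M -> smod_e_injective M.
Proof.
move=> injM A B C f g [kerf cokg]; split; first exact: hom_precomp_kernel.
exact: hom_precomp_cokernel.
Qed.

End IdempotentSemiring.

Theorem theorem4p5 (S : pzSemiRingType) (idemS : additively_idempotent S) :
  (forall M : lSemiModType S,
     exists E : lSemiModType S, smod_e_injective E /\ smod_embeds_in M E) /\
  (forall M : lSemiModType S, smod_injective M -> smod_e_injective M).
Proof.
split=> M; last exact: smod_injective_e_injective.
exists (prop_coind S M); split; last exact: smod_embeds_in_prop_coind.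
by apply: smod_injective_e_injective => //; exact: prop_coind_injective.
Qed.
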